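(* Let $d,d_0\in\mathbb{N}$, let $a=(a_{ij})_{1\le i<j\le d_0}$ with $a_{ij}\neq0$ for all $j>i$, and let $\mathcal{H}_{\mathrm{FM}}(\bullet;a):\mathbb{R}^{d\times d_0}\to\mathbb{R}^{(d_0-1)d_0/2}$ be given by $$\mathcal{H}_{\mathrm{FM}}(P;a):=\bigl(a_{ij}\,p_i^{\mathrm T}p_j\bigr)_{1\le i<j\le d_0},$$ where $p_1,\dots,p_{d_0}\in\mathbb{R}^d$ are the columns of $P$. Given $P\in\mathbb{R}^{d\times d_0}$, if $$d\ge\dim\bigl(\operatorname{span}(\{p_i\}_{i=1}^{d_0})\bigr)+d_0-1,$$ then $\mathcal{H}_{\mathrm{FM}}(\bullet;a)$ is locally surjective at $P$. In particular, if $d\ge 2d_0-1$, then $\mathcal{H}_{\mathrm{FM}}(\bullet;a)$ is locally surjective at every point of $\mathbb{R}^{d\times d_0}$.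
   Context: $\mathbb{N}$ is the set of positive integers. Matrix spaces carry the Frobenius norm, vector spaces the Euclidean norm, and $\mathbb{B}$ denotes the closed unit ball of the relevant space. Entries indexed by pairs $i<j$ are ordered lexicographically. A mapping $\mathcal{F}$ between Euclidean spaces is locally surjective at $x$ if for any $t>0$ there exists $r>0$ such that $\mathcal{F}(x)+r\mathbb{B}\subseteq\mathcal{F}(x+t\mathbb{B})$. *)

(* Defs.v *)
From mathcomp Require Import all_boot all_order all_algebra.
From mathcomp Require Import classical_sets reals.

Set Implicit Arguments.
Unset Strict Implicit.
Unset Printing Implicit Defensive.

Import Order.TTheory GRing.Theory Num.Theory.

Local Open Scope classical_set_scope.
Local Open Scope ring_scope.

(* On column vectors (n = 1) this is the Euclidean norm. The norm that
   MathComp-Analysis puts on matrices is the sup norm, hence this definition. *)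
Definition frobnorm (R : realType) (m n : nat) (A : 'M[R]_(m, n)) : R :=
  Num.sqrt (\sum_i \sum_j A i j ^+ 2).

Definition unit_ball (R : realType) (m n : nat) : set 'M[R]_(m, n) :=
  [set U | frobnorm U <= 1].

(* The set x + r B. *)
Definition cball (R : realType) (m n : nat) (x : 'M[R]_(m, n)) (r : R) :
    set 'M[R]_(m, n) :=
  [set x + r *: U | U in @unit_ball R m n].

Definition locally_surjective (R : realType) (m n p q : nat)
    (F : 'M[R]_(m, n) -> 'M[R]_(p, q)) (x : 'M[R]_(m, n)) : Prop :=
  forall t : R, 0 < t ->
    exists2 r : R, 0 < r & cball (F x) r `<=` F @` cball x t.

(* The comprehension enumerates pairs in row-major order, so the pairs i < j
   come in lexicographic order. *)
Definition lt_pairs (n : nat) : seq ('I_n * 'I_n) :=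
  [seq ij : 'I_n * 'I_n <- [seq (i, j) | i <- enum 'I_n, j <- enum 'I_n]
     | (ij.1 < ij.2)%N].

Lemma size_lt_pairs (n : nat) : size (lt_pairs n) == (((n - 1) * n)./2)%N.
Proof.
rewrite /lt_pairs size_filter count_flatten -map_comp sumnE big_map big_enum /=.
under eq_bigr => i _.
  rewrite count_map /= -size_filter -count_predT count_filter -sum1_count.
  rewrite big_enum_cond /= big_mkcond /=.
  over.
rewrite exchange_big /=.
under eq_bigr => j _.
  rewrite -big_mkcond /= -(big_ord_widen n (fun=> 1%N) (ltnW (ltn_ord j))).
  rewrite sum1_card card_ord.
  over.
by rewrite -(big_mkord xpredT id) bin2_sum bin2 mulnC subn1.
Qed.

Definition lt_pairs_tuple (n : nat) : (((n - 1) * n)./2).-tuple ('I_n * 'I_n) :=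
  Tuple (size_lt_pairs n).

(* Only the entries a i j with i < j are used. *)
Definition H_FM (R : realType) (d d0 : nat) (a : 'I_d0 -> 'I_d0 -> R)
    (P : 'M[R]_(d, d0)) : 'cV[R]_(((d0 - 1) * d0)./2) :=
  \col_k (let: (i, j) := tnth (lt_pairs_tuple d0) k in
          a i j * ((col i P)^T *m col j P) 0 0).

(* Main.v *)
(** Write [p_i] for the columns of [P].  The orthogonal complement of their span
    contains an orthonormal family [e_1, ..., e_(d0-1)].  Adding to [p_i] a vector
    [u_i] of the span of the [e_l] changes [p_i . p_j] by exactly [u_i . u_j], so
    it is enough to find small [u_i] whose off-diagonal inner products are a given
    small [s_ij].  The ansatz [u_i = eps (e_i + \sum_(l < i) c_il e_l)], without
    the term [e_i] for [i = d0], turns this into the triangular system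
    [eps^2 (c_ji + \sum_(l < i) c_il c_jl) = s_ij], solved by recursion on [i]. *)
Require Import Defs.
From mathcomp Require Import all_boot all_order all_algebra.
From mathcomp Require Import classical_sets reals.
From mathcomp Require Import ring.

Set Implicit Arguments.
Unset Strict Implicit.
Unset Printing Implicit Defensive.

Import Order.TTheory GRing.Theory Num.Theory.

Local Open Scope ring_scope.

(** Gram-Schmidt by induction on [m]: the [k] columns of [B] and the [m] rows already found have
    rank at most [k + m < d], so a nonzero row vector is orthogonal to all of them; normalized, it
    becomes the next row. *)
Lemma orthonormal_complement (R : rcfType) (d k m : nat) (B : 'M[R]_(d, k)) :
  (k + m <= d)%N ->
  exists E : 'M[R]_(m, d), E *m B = 0 /\ E *m E^T = 1%:M.
Proof.
elim: m => [|m IHm] lekmd.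
  by exists 0; split; rewrite mul0mx // [RHS]flatmx0.
have [|E [EB EE]] := IHm; first by apply: leq_trans lekmd; rewrite leq_add2l.
have /rowV0Pn [v /sub_kermxP vBE v_neq0] : kermx (row_mx B E^T) != 0.
  rewrite -mxrank_eq0 mxrank_ker subn_eq0 -ltnNge.
  by apply: leq_ltn_trans (rank_leq_col _) _; rewrite -addnS.
move: vBE; rewrite mul_mx_row -[RHS]row_mx0 => /eq_row_mx [vB vE].
pose q := (v *m v^T) 0 0.
have qE : q = \sum_j v 0 j ^+ 2.
  by rewrite /q mxE; apply: eq_bigr => j _; rewrite mxE expr2.
have q_gt0 : 0 < q.
  rewrite lt0r qE sumr_ge0 ?andbT => [|j _]; last exact: sqr_ge0.
  apply: contra v_neq0 => /eqP /psumr_eq0P v0.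
  apply/eqP/rowP => j; rewrite mxE; apply/eqP; rewrite -sqrf_eq0.
  by apply/eqP/v0 => // i _; apply: sqr_ge0.
pose w := (Num.sqrt q)^-1 *: v.
have wB : w *m B = 0 by rewrite -scalemxAl vB scaler0.
have wE : w *m E^T = 0 by rewrite -scalemxAl vE scaler0.
have ww : w *m w^T = 1%:M.
  rewrite linearZ /= -scalemxAl -scalemxAr scalerA [v *m _]mx11_scalar -/q.
  by rewrite scale_scalar_mx -expr2 exprVn sqr_sqrtr ?mulVf ?gt_eqF // ltW.
rewrite -add1n; exists (col_mx w E); split.
  by rewrite mul_col_mx wB EB col_mx0.
rewrite tr_col_mx mul_col_row ww wE EE.
by rewrite -[E *m w^T]trmxK trmx_mul trmxK wE trmx0 -scalar_mx_block.
Qed.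

(** Orthogonality is imposed on a basis of the column span only, so that the dimension of the span
    is counted and not the number of columns. *)
Lemma orthonormal_to_cols (R : rcfType) (d n m : nat) (P : 'M[R]_(d, n)) :
  (\dim <<[seq col i P | i : 'I_n]>>%VS + m <= d)%N ->
  exists E : 'M[R]_(m, d), E *m P = 0 /\ E *m E^T = 1%:M.
Proof.
set V := <<_>>%VS => /(orthonormal_complement
  (\matrix_(i, k) (vbasis V)`_k i 0)) [E [EB EE]].
exists E; split=> //; apply/matrixP => l j.
have /coord_vbasis colP : col j P \in V.
  by apply/memv_span/mapP; exists j; rewrite ?mem_enum.
have -> : (E *m P) l j = (E *m col j P) l 0 by rewrite !colE mulmxA -colE [RHS]mxE.
rewrite colP mulmx_sumr summxE mxE big1 // => k _.
rewrite -scalemxAr mxE.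
suff -> : (E *m (vbasis V)`_k) l 0 = 0 by rewrite mulr0.
have /matrixP /(_ l k) := EB; rewrite [RHS]mxE => <-.
by rewrite !mxE; apply: eq_bigr => i _; rewrite mxE.
Qed.

(* The radius 1 / (4N) comes from: if [|c| <= m := 1 / (2N)], then a right-hand
   side [s - \sum_(l < i) c_il c_jl] is at most [1 / (4N) + N m^2 = m]. *)
Lemma triangular_system (R : realFieldType) (N k : nat) (s : nat -> nat -> R) :
  (k <= N)%N -> (forall i j, `|s i j| <= (4 * N%:R)^-1) ->
  exists c : nat -> nat -> R,
    (forall i j, (i < k)%N -> `|c j i| <= (2 * N%:R)^-1) /\
    (forall i j, (i < k)%N -> c j i + \sum_(l < i) c i l * c j l = s i j).
Proof.
move=> + s_le; elim: k => [_|k IHk ltkN]; first by exists (fun _ _ => 0).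
have [c [c_le cE]] := IHk (ltnW ltkN).
have N_gt0 : 0 < N%:R :> R by rewrite ltr0n; case: (N) ltkN.
(* The equations with first index [k] involve only columns up to [k], and column [k] enters through
   [c j k] alone. Solving for it leaves the earlier equations intact. *)
pose c' j i := if i == k then s k j - \sum_(l < k) c k l * c j l else c j i.
have c'E j i : (i < k)%N -> c' j i = c j i by rewrite /c' => /ltn_eqF ->.
exists c'; split=> i j; rewrite ltnS leq_eqVlt => /orP [/eqP ->|ltik].
- rewrite /c' eqxx; apply: le_trans (ler_normB _ _) _.
  have sum_le : `|\sum_(l < k) c k l * c j l| <= (4 * N%:R)^-1.
    apply: le_trans (ler_norm_sum _ _ _) _.
    apply: (@le_trans _ _ (\sum_(l < k) (2 * N%:R)^-1 ^+ 2)).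
      by apply: ler_sum => l _; rewrite normrM expr2 ler_pM ?c_le.
    rewrite sumr_const card_ord -[X in X <= _]mulr_natl.
    apply: (@le_trans _ _ (N%:R * (2 * N%:R)^-1 ^+ 2)).
      by rewrite ler_wpM2r ?sqr_ge0 // ler_nat ltnW.
    by rewrite le_eqVlt; apply/orP; left; apply/eqP; field; rewrite gt_eqF.
  apply: le_trans (lerD (s_le _ _) sum_le) _.
  by rewrite le_eqVlt; apply/orP; left; apply/eqP; field; rewrite gt_eqF.
- by rewrite c'E // c_le.
- rewrite {1}/c' eqxx [X in _ + X](eq_bigr (fun l : 'I_k => c k l * c j l)).
    by rewrite subrK.
  by move=> l _; rewrite !c'E.
- rewrite c'E // [X in _ + X](eq_bigr (fun l : 'I_i => c i l * c j l)) ?cE //.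
  by move=> l _; rewrite !c'E // (ltn_trans _ ltik).
Qed.

Lemma gram_strict_upper (R : realFieldType) (n : nat) (s : 'M[R]_n.+1) :
  (forall i j, `|s i j| <= (4 * n.+1%:R)^-1) ->
  exists C : 'M[R]_(n, n.+1),
    (forall l i, `|C l i| <= 1) /\
    (forall i j : 'I_n.+1, (i < j)%N -> (C^T *m C) i j = s i j).
Proof.
move=> s_le.
have [//|c [c_le cE]] := @triangular_system _ n.+1 n
  (fun i j => s (inord i) (inord j)) (leqnSn n).
(* Column [i] holds the coordinates of [u_i / eps] in the [e_l]: [c i l] above the diagonal, 1 on
   it, 0 below. With only [n] rows, the last column has no diagonal entry. *)
pose C : 'M[R]_(n, n.+1) :=
  \matrix_(l, i) (if (l < i)%N then c i l else (l == i :> nat)%:R).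
exists C; split=> [l i|i j ltij].
  rewrite mxE; case: ifP => _; last by case: eqP; rewrite ?normr1 ?normr0.
  apply: le_trans (c_le _ _ (ltn_ord l)) _.
  rewrite invf_le1 ?mulr_gt0 ?ltr0n // -natrM ler1n.
  by rewrite muln_gt0.
have ltin : (i < n)%N by apply: leq_trans ltij _; rewrite -ltnS.
have := cE i j ltin; rewrite !inord_val => <-.
(* The term [l = i] of the inner product is [c j i], and the terms [l > i] vanish. *)
rewrite mxE (bigD1 (Ordinal ltin)) //= !mxE /= ltnn eqxx mul1r ltij.
congr (_ + _); rewrite (big_ord_widen n (fun l => c i l * c j l) (ltnW ltin)).
rewrite big_mkcond [RHS]big_mkcond; apply: eq_bigr => l _; rewrite !mxE -val_eqE /=.
case: (ltngtP l i) => //= [ltli|_]; last by rewrite mul0r.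
by rewrite (ltn_trans ltli ltij).
Qed.

(** Gives [E^T *m C] the norm of [C] when the rows of [E] are orthonormal, as both have the same
    Gram matrix. *)
Lemma frobnorm_tr (R : realType) (m n : nat) (A : 'M[R]_(m, n)) :
  frobnorm A = Num.sqrt (\tr (A^T *m A)).
Proof.
rewrite /frobnorm /mxtrace exchange_big; congr Num.sqrt.
apply: eq_bigr => j _; rewrite mxE; apply: eq_bigr => i _.
by rewrite mxE expr2.
Qed.

Lemma frobnormZ (R : realType) (m n : nat) (c : R) (A : 'M[R]_(m, n)) :
  0 <= c -> frobnorm (c *: A) = c * frobnorm A.
Proof.
move=> c_ge0; rewrite /frobnorm -[in RHS](ger0_norm c_ge0) -sqrtr_sqr.
rewrite -sqrtrM ?sqr_ge0 // mulr_sumr; congr Num.sqrt.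
apply: eq_bigr => i _; rewrite mulr_sumr; apply: eq_bigr => j _.
by rewrite mxE exprMn.
Qed.

Lemma entry_le_frobnorm (R : realType) (m n : nat) (A : 'M[R]_(m, n)) i j :
  `|A i j| <= frobnorm A.
Proof.
rewrite -sqrtr_sqr ler_wsqrtr // (bigD1 i) //= (bigD1 j) //= -addrA lerDl.
rewrite addr_ge0 ?sumr_ge0 // => [k _|k _]; first exact: sqr_ge0.
by apply: sumr_ge0 => l _; apply: sqr_ge0.
Qed.

Lemma frobnorm_le_dim (R : realType) (m n : nat) (C : 'M[R]_(m, n)) :
  (m <= n)%N -> (forall l i, `|C l i| <= 1) -> frobnorm C <= n%:R.
Proof.
move=> lemn C_le; rewrite -[leRHS]ger0_norm ?ler0n // -sqrtr_sqr ler_wsqrtr //.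
apply: (@le_trans _ _ (\sum_(l < m) \sum_(i < n) 1)).
  apply: ler_sum => l _; apply: ler_sum => i _.
  by rewrite -real_normK ?num_real // expr_le1.
rewrite !sumr_const !card_ord -mulrnA -natrX ler_nat.
by rewrite -mulnn leq_mul2l lemn orbT.
Qed.

Lemma lt_pairs_uniq (n : nat) : uniq (lt_pairs n).
Proof. by rewrite filter_uniq // allpairs_uniq ?enum_uniq // => -[? ?] [? ?]. Qed.

Lemma tnth_lt_pairs_inj (n : nat) : injective (tnth (lt_pairs_tuple n)).
Proof. exact/tuple_uniqP/lt_pairs_uniq. Qed.

Lemma tnth_lt_pairs_lt (n : nat) k :
  ((tnth (lt_pairs_tuple n) k).1 < (tnth (lt_pairs_tuple n) k).2)%N.
Proof. by have := mem_tnth k (lt_pairs_tuple n); rewrite mem_filter => /andP []. Qed.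

Lemma gram_entry (R : pzSemiRingType) (m n : nat) (P : 'M[R]_(m, n)) i j :
  ((col i P)^T *m col j P) 0 0 = (P^T *m P) i j.
Proof. by rewrite !mxE; apply: eq_bigr => k _; rewrite !mxE. Qed.

Lemma locally_surjective_H_FM (R : realType) (d n : nat)
    (a : 'I_n.+1 -> 'I_n.+1 -> R) (P : 'M[R]_(d, n.+1)) (E : 'M[R]_(n, d)) :
  (forall i j : 'I_n.+1, (i < j)%N -> a i j != 0) ->
  E *m P = 0 -> E *m E^T = 1%:M -> locally_surjective (H_FM a) P.
Proof.
move=> a_neq0 EP EE t t_gt0.
pose T := tnth (lt_pairs_tuple n.+1); pose b k := a (T k).1 (T k).2.
have b_neq0 k : b k != 0 by apply: a_neq0; apply: tnth_lt_pairs_lt.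
(* The summand 1 keeps [M] positive even when there are no pairs, that is, for [n = 0]. *)
pose M := 1 + \sum_k `|b k|^-1.
have M_gt0 : 0 < M.
  by rewrite ltr_pwDl // sumr_ge0 // => k _; rewrite invr_ge0.
have b_le k : `|b k|^-1 <= M.
  rewrite /M (bigD1 k) //= addrCA lerDl addr_ge0 ?sumr_ge0 // => l _.
  by rewrite invr_ge0.
have n_gt0 : 0 < n.+1%:R :> R by rewrite ltr0n.
(* The norm of [C] will be at most [n.+1], so the perturbation [eps *: (E^T *m C)] stays within
   [t]. *)
pose eps := t / n.+1%:R.
have eps_gt0 : 0 < eps by rewrite divr_gt0.
have [r rE] : exists r, r = eps ^+ 2 * (4 * n.+1%:R)^-1 / M by eexists.
have r_gt0 : 0 < r by rewrite rE !mulr_gt0 ?invr_gt0 ?exprn_gt0 ?mulr_gt0.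
exists r => // _ [U U_le1 <-].
(* The Gram entry of [C] required at the [k]-th pair: weighted by [eps ^+ 2] and [b k], it yields
   the target increment [r * U k 0]. The choice of [r] makes its bound [r * M / eps ^+ 2] equal to
   the radius of the triangular system. *)
pose sigma k := r * U k 0 / b k / eps ^+ 2.
have sigma_le k : `|sigma k| <= (4 * n.+1%:R)^-1.
  have Uk_le1 := le_trans (entry_le_frobnorm U k 0) U_le1.
  have -> : (4 * n.+1%:R)^-1 = r * 1 * M / eps ^+ 2.
    by rewrite rE; field; rewrite !gt_eqF // addrC natr1.
  rewrite /sigma !normrM !normfV (gtr0_norm r_gt0).
  rewrite (gtr0_norm (exprn_gt0 2 eps_gt0)).
  rewrite ler_wpM2r ?invr_ge0 ?sqr_ge0 // ler_pM ?b_le //; last first.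
    exact: ler_wpM2l (ltW r_gt0) _ _ Uk_le1.
  - by rewrite invr_ge0.
  - by rewrite mulr_ge0 // ltW.
(* Entries outside the pairs [i < j] are free; the value 0 respects the bound. *)
pose s : 'M[R]_n.+1 :=
  \matrix_(i, j) (if [pick k | T k == (i, j)] is Some k then sigma k else 0).
have s_le i j : `|s i j| <= (4 * n.+1%:R)^-1.
  rewrite mxE; case: pickP => [k _|_]; first exact: sigma_le.
  by rewrite normr0 invr_ge0 mulr_ge0.
have sE k : s (T k).1 (T k).2 = sigma k.
  rewrite mxE -surjective_pairing.
  by case: pickP => [l /eqP /tnth_lt_pairs_inj -> //|/(_ k)]; rewrite eqxx.
have [C [C_le CE]] := gram_strict_upper s_le.
have CEEC : (E^T *m C)^T *m (E^T *m C) = C^T *m C.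
  by rewrite trmx_mul trmxK -mulmxA (mulmxA E) EE mul1mx.
exists (P + eps *: (E^T *m C)).
  exists ((n.+1%:R)^-1 *: (E^T *m C)); last by rewrite scalerA.
  rewrite /unit_ball /= frobnormZ ?invr_ge0 // frobnorm_tr CEEC -frobnorm_tr.
  by rewrite mulrC ler_pdivrMr // mul1r frobnorm_le_dim.
have PEC : P^T *m (E^T *m C) = 0 by rewrite mulmxA -trmx_mul EP trmx0 mul0mx.
have ECP : (E^T *m C)^T *m P = 0 by rewrite trmx_mul trmxK -mulmxA EP mulmx0.
apply/colP => k; rewrite !mxE.
have := sE k; have := tnth_lt_pairs_lt k; have := b_neq0 k.
rewrite /sigma /b -/T; case: (T k) => i j /= aij ltij sij; rewrite !gram_entry.
(* The cross terms vanish because [E *m P = 0], so the perturbation acts purely quadratically. *)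
have -> : (P + eps *: (E^T *m C))^T *m (P + eps *: (E^T *m C)) =
          P^T *m P + eps ^+ 2 *: (C^T *m C).
  rewrite [(P + _)^T]linearD linearZ /= mulmxDl !mulmxDr.
  by rewrite -!scalemxAl -!scalemxAr CEEC PEC ECP !scaler0 addr0 add0r scalerA expr2.
rewrite mxE [in X in _ + X]mxE CE // sij.
by field; rewrite aij gt_eqF.
Qed.

Theorem theorem3p12 (R : realType) (d d0 : nat) (a : 'I_d0 -> 'I_d0 -> R)
    (d_gt0 : (0 < d)%N) (d0_gt0 : (0 < d0)%N)
    (a_neq0 : forall i j : 'I_d0, (i < j)%N -> a i j != 0) :
  (forall P : 'M[R]_(d, d0),
     (\dim <<[seq col i P | i : 'I_d0]>>%VS + d0 - 1 <= d)%N ->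
     locally_surjective (H_FM a) P) /\
  ((2 * d0 - 1 <= d)%N ->
     forall P : 'M[R]_(d, d0), locally_surjective (H_FM a) P).
Proof.
case: d0 d0_gt0 a a_neq0 => // n _ a a_neq0.
have main (P : 'M[R]_(d, n.+1)) :
    (\dim <<[seq col i P | i : 'I_n.+1]>>%VS + n.+1 - 1 <= d)%N ->
    locally_surjective (H_FM a) P.
  rewrite addnS subn1 => /orthonormal_to_cols [E [EP EE]].
  exact: locally_surjective_H_FM EP EE.
split=> // le_d P; apply: main; apply: leq_trans le_d.
(* The span of [d0] columns has dimension at most [d0]. *)
rewrite leq_sub2r // mul2n -addnn leq_add2r.
by apply: leq_trans (dim_span _) _; rewrite size_map -cardE card_ord.
Qed.
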